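(* For any integers $L,M$, the following identity holds as formal power series in $a,b,c$ (with coefficients rational functions of $q$): \[ \sum_{i\ge 0}a^iq^{T_i}\left(-\frac{c}{a}q;q\right)_i(-bq^{i+1};q)_{L-i}{M\brack i}_q=\sum_{i,j,k\ge0}a^ib^jc^kq^{T_{i+j+k}+T_k}{M-i\brack k}_q{M\brack i}_q{L-i-k\brack j}_q . \]
   Context: $T_k=k(k+1)/2$. For any integer $n$: $(x;q)_n=\prod_{j=0}^{n-1}(1-xq^j)$ if $n\ge0$ and $(x;q)_n=1/\prod_{j=1}^{-n}(1-xq^{-j})$ if $n<0$. For any integer $n$ and integer $k\ge 0$, ${n\brack k}_q=\frac{(q^{n-k+1};q)_k}{(q;q)_k}$ (for $n\ge0$ this is the usual Gaussian binomial coefficient, which vanishes for $k>n$); ${n\brack k}_q=0$ for $k<0$. The term $a^i(-\tfrac{c}{a}q;q)_i$ is a polynomial in $a,c$. *)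

(* Defs.v *)
From HB Require Import structures.
From mathcomp Require Import all_boot all_order all_algebra.
From mathcomp Require Import boolp classical_sets cardinality fsbigop.

Set Implicit Arguments.
Unset Strict Implicit.
Unset Printing Implicit Defensive.

Import GRing.Theory.
Local Open Scope ring_scope.

(* Formal power series in one variable, with the Cauchy product.  Several     *)
(* variables are obtained by iteration.                                       *)

Record fps (R : Type) := Fps { fcoef : nat -> R }.

HB.instance Definition _ (R : Type) := gen_eqMixin (fps R).
HB.instance Definition _ (R : Type) := gen_choiceMixin (fps R).

Lemma fpsP (R : Type) (f g : fps R) : fcoef f =1 fcoef g -> f = g.
Proof. by case: f g => [f] [g] /funext /= ->. Qed.

Section FpsRing.
Variable R : comNzRingType.
Implicit Types f g h : fps R.

Definition fpsC (c : R) : fps R := Fps (fun n => if n == 0%N then c else 0).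
Definition fpsX : fps R := Fps (fun n => (n == 1%N)%:R).
Definition fps_add f g : fps R := Fps (fun n => fcoef f n + fcoef g n).
Definition fps_opp f : fps R := Fps (fun n => - fcoef f n).
Definition fps_mul f g : fps R :=
  Fps (fun n => \sum_(i < n.+1) fcoef f i * fcoef g (n - i)).

Fact fps_addA : associative fps_add.
Proof. by move=> f g h; apply: fpsP => n /=; rewrite addrA. Qed.
Fact fps_addC : commutative fps_add.
Proof. by move=> f g; apply: fpsP => n /=; rewrite addrC. Qed.
Fact fps_add0 : left_id (fpsC 0) fps_add.
Proof. by move=> f; apply: fpsP => n /=; rewrite if_same add0r. Qed.
Fact fps_addN : left_inverse (fpsC 0) fps_opp fps_add.
Proof. by move=> f; apply: fpsP => n /=; rewrite if_same addNr. Qed.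

HB.instance Definition _ := GRing.isZmodule.Build (fps R)
  fps_addA fps_addC fps_add0 fps_addN.

Definition fps_trunc N f : {poly R} := \poly_(i < N) fcoef f i.

Lemma fps_truncE N f n : (n < N)%N -> (fps_trunc N f)`_n = fcoef f n.
Proof. by move=> ltnN; rewrite coef_poly ltnN. Qed.

Lemma fps_mul_trunc N f g n : (n < N)%N ->
  fcoef (fps_mul f g) n = (fps_trunc N f * fps_trunc N g)`_n.
Proof.
move=> ltnN; rewrite coefM; apply: eq_bigr => i _.
rewrite !fps_truncE ?(leq_ltn_trans (leq_subr _ _) ltnN) //.
by rewrite (leq_trans (ltn_ord i)).
Qed.

Fact fps_mulC : commutative fps_mul.
Proof.
by move=> f g; apply: fpsP => n; rewrite !(@fps_mul_trunc n.+1) // mulrC.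
Qed.

Fact fps_mulA : associative fps_mul.
Proof.
move=> f g h; apply: fpsP => n; have le_n (i : 'I_n.+1) : (n - i < n.+1)%N.
  by rewrite ltnS leq_subr.
transitivity ((fps_trunc n.+1 f * (fps_trunc n.+1 g * fps_trunc n.+1 h))`_n).
  rewrite coefM; apply: eq_bigr => i _.
  by rewrite -(fps_mul_trunc _ _ (le_n i)) fps_truncE.
rewrite mulrA coefM; apply: eq_bigr => i _.
by rewrite -(fps_mul_trunc _ _ (ltn_ord i)) fps_truncE.
Qed.

Fact fps_mul1 : left_id (fpsC 1) fps_mul.
Proof.
move=> f; apply: fpsP => n /=; rewrite big_ord_recl /= mul1r subn0.
by rewrite big1 ?addr0 // => i _; rewrite mul0r.
Qed.

Fact fps_mulDl : left_distributive fps_mul fps_add.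
Proof.
move=> f g h; apply: fpsP => n /=; rewrite -big_split /=.
by apply: eq_bigr => i _; rewrite mulrDl.
Qed.

Fact fps_oner_neq0 : fpsC 1 != 0.
Proof.
by apply/eqP => /(congr1 (fun f => fcoef f 0)) /eqP; rewrite /= oner_eq0.
Qed.

HB.instance Definition _ := GRing.Zmodule_isComNzRing.Build (fps R)
  fps_mulA fps_mulC fps_mul1 fps_mulDl fps_oner_neq0.

Lemma fcoef0 n : fcoef (0 : fps R) n = 0.
Proof. exact: if_same. Qed.
Lemma fcoefD f g n : fcoef (f + g) n = fcoef f n + fcoef g n.
Proof. by []. Qed.
Lemma fcoefN f n : fcoef (- f) n = - fcoef f n.
Proof. by []. Qed.
Lemma fcoefM f g n :
  fcoef (f * g) n = \sum_(i < n.+1) fcoef f i * fcoef g (n - i).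
Proof. by []. Qed.
Lemma fcoef_sum (I : Type) (r : seq I) (P : pred I) (F : I -> fps R) n :
  fcoef (\sum_(i <- r | P i) F i) n = \sum_(i <- r | P i) fcoef (F i) n.
Proof. by elim/big_rec2: _ => [|i x y _ <-] //; exact: fcoef0. Qed.

Lemma fcoefX_low h N n : fcoef h 0 = 0 -> (n < N)%N -> fcoef (h ^+ N) n = 0.
Proof.
move=> h0; elim: N n => // N IHN n ltnN.
rewrite exprS fcoefM big_ord_recl h0 mul0r add0r big1 // => i _.
rewrite IHN ?mulr0 //= /bump /= add1n.
by case: n ltnN i => [|n] ltnN i; [case: i | rewrite subSS (leq_ltn_trans (leq_subr _ _))].
Qed.

End FpsRing.

(* A power series is invertible exactly when its constant coefficient is; the *)
(* inverse is the geometric series u^-1 * sum_k (1 - u^-1 f)^k, u := f_0.      *)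
Section FpsUnit.
Variable R : comUnitRingType.
Implicit Types f g h : fps R.

Definition fps_unit : pred (fps R) := fun f => fcoef f 0 \is a GRing.unit.

Definition fps_geom h : fps R :=
  Fps (fun n => \sum_(k < n.+1) fcoef (h ^+ k) n).

Definition fps_inv f : fps R :=
  if fps_unit f then
    fpsC (fcoef f 0)^-1 * fps_geom (1 - fpsC (fcoef f 0)^-1 * f)
  else f.

Lemma fps_geomE h N n : fcoef h 0 = 0 -> (n < N)%N ->
  fcoef (fps_geom h) n = fcoef (\sum_(k < N) h ^+ k) n.
Proof.
move=> h0 ltnN; rewrite fcoef_sum /=.
rewrite (big_ord_widen N (fun k => fcoef (h ^+ k) n)) //.
rewrite big_mkcond; apply: eq_bigr => k _; rewrite ltnS.
by case: leqP => // ltnk; rewrite fcoefX_low.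
Qed.

Lemma fps_geomP h : fcoef h 0 = 0 -> (1 - h) * fps_geom h = 1.
Proof.
move=> h0; apply: fpsP => n.
have -> : fcoef ((1 - h) * fps_geom h) n =
          fcoef ((1 - h) * \sum_(k < n.+1) h ^+ k) n.
  rewrite !fcoefM; apply: eq_bigr => i _.
  by rewrite (@fps_geomE _ n.+1) // ltnS leq_subr.
have -> : (1 - h) * (\sum_(k < n.+1) h ^+ k) = 1 - h ^+ n.+1.
  by rewrite -[RHS]opprB subrX1 -mulNr opprB.
by rewrite fcoefD fcoefN fcoefX_low // subr0.
Qed.

Fact fps_mulVf : {in fps_unit, left_inverse 1 fps_inv *%R}.
Proof.
move=> f uf; rewrite /fps_inv ifT //; set u := fpsC _; set h := 1 - u * f.
have h0 : fcoef h 0 = 0.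
  by rewrite fcoefD fcoefN fcoefM big_ord1 /= mulVr ?subrr.
have -> : u * fps_geom h * f = (1 - h) * fps_geom h.
  by rewrite mulrAC /h subKr.
exact: fps_geomP.
Qed.

Fact fps_unitP f g : g * f = 1 -> fps_unit f.
Proof.
move=> /(congr1 (fun f => fcoef f 0)); rewrite fcoefM big_ord1 subn0 mulrC => fg1.
by apply/unitrPr; exists (fcoef g 0).
Qed.

Fact fps_inv_out : {in [predC fps_unit], fps_inv =1 id}.
Proof. by move=> f; rewrite inE /= /fps_inv => /negbTE; rewrite /in_mem /= => ->. Qed.

HB.instance Definition _ := GRing.ComNzRing_hasMulInverse.Build (fps R)
  fps_mulVf fps_unitP fps_inv_out.

End FpsUnit.

(* K[[a,b,c]], with a the outermost and c the innermost variable. *)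
Section Fps3.
Variable K : fieldType.

Definition fps3 := fps (fps (fps K)).

HB.instance Definition _ := GRing.ComUnitRing.on fps3.

Definition fps3C (x : K) : fps3 := fpsC (fpsC (fpsC x)).
Definition fps3a : fps3 := fpsX (fps (fps K)).
Definition fps3b : fps3 := fpsC (fpsX (fps K)).
Definition fps3c : fps3 := fpsC (fpsC (fpsX K)).

(* the coefficient of a^i b^j c^k *)
Definition coef3 (f : fps3) (i j k : nat) : K :=
  fcoef (fcoef (fcoef f i) j) k.

(* A family of power series can be summed when every monomial occurs in only  *)
(* finitely many members; the sum is then taken coefficientwise.  (The finite *)
(* support sum is 0 by convention on a family that is not summable.)          *)
Definition fps3_summable (I : choiceType) (F : I -> fps3) : Prop :=
  forall i j k : nat, finite_set [set x : I | coef3 (F x) i j k <> 0].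

Definition fps3_sum (I : choiceType) (F : I -> fps3) : fps3 :=
  Fps (fun i => Fps (fun j => Fps (fun k =>
    \sum_(x \in [set: I]) coef3 (F x) i j k))).

End Fps3.

Section QSeries.

Definition qpoch (R : comUnitRingType) (x q : R) (n : int) : R :=
  match n with
  | Posz m => \prod_(0 <= j < m) (1 - x * q ^+ j)
  | Negz m => (\prod_(1 <= j < m.+2) (1 - x * q ^- j))^-1
  end.

(* a^i (x/a; q)_i as a polynomial in a and x.  It is needed in K[[a,b,c]],    *)
(* where a is not invertible; [qpoch_homE] is the usual form when a is.       *)
Definition qpoch_hom (R : comUnitRingType) (a x q : R) (i : nat) : R :=
  \prod_(0 <= j < i) (a - x * q ^+ j).

Lemma qpoch_homE (R : comUnitRingType) (a x q : R) (i : nat) :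
  a \is a GRing.unit -> qpoch_hom a x q i = a ^+ i * qpoch (x / a) q i.
Proof.
move=> ua; rewrite /qpoch_hom /= -[i in a ^+ i]subn0 -prodr_const_nat -big_split.
apply: eq_bigr => j _ /=.
by rewrite mulrBr mulr1 mulrA (mulrCA a) mulrV // mulr1.
Qed.

Definition qbinom (K : fieldType) (q : K) (n k : int) : K :=
  match k with
  | Posz m => qpoch (q ^ (n - k + 1)) q m / qpoch q q m
  | Negz _ => 0
  end.

Definition tri (k : nat) : nat := (k * k.+1) %/ 2.

End QSeries.

(* The field of rational functions over F, and its variable. *)
Definition ratfun (F : fieldType) : fieldType := {fraction {poly F}}.
Definition ratX (F : fieldType) : ratfun F := tofrac ('X : {poly F}).

(* Main.v *)
(** Expand both sides into monomials. By the [q]-binomial theorem, for natural and for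
    arbitrary integral exponent respectively,
      [prod_(1 <= s <= i) (a + c q^s) = sum_k [i,k] q^(T_k) a^(i-k) c^k],
      [(-b q^(i+1); q)_(L-i) = sum_j [L-i,j] q^(T_j + i j) b^j],
    so the monomial [a^i b^j c^k] occurs only in the [(i+k)]-th term on the left, and only in
    the term [(i,j,k)] on the right. The two coefficients agree by
    [T_(i+k) + T_j + (i+k) j = T_(i+j+k)] and [[M,i+k] [i+k,k] = [M,i] [M-i,k]]. *)
Require Import Defs.
From HB Require Import structures.
From mathcomp Require Import all_boot all_order all_algebra.
From mathcomp Require Import boolp classical_sets cardinality fsbigop.
From mathcomp Require Import ring zify.

Set Implicit Arguments.
Unset Strict Implicit.
Unset Printing Implicit Defensive.

Import GRing.Theory.
Local Open Scope ring_scope.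

(* The coefficients are computed over an abstract ring [S]: unifying the several convertible
   ring structures of [fps3 K] unfolds the nested Cauchy products. *)
Record power_series_ring (K : fieldType) (S : comUnitRingType)
    (C : {rmorphism K -> S}) (a b c : S) (co : S -> nat -> nat -> nat -> K) :=
  PowerSeriesRing {
    coD : forall f g i j k, co (f + g) i j k = co f i j k + co g i j k;
    coC : forall x i j k, co (C x) i j k = if (i, j, k) == (0, 0, 0)%N then x else 0;
    coCM : forall x f i j k, co (C x * f) i j k = x * co f i j k;
    coaM : forall f i j k, co (a * f) i j k = if i is i'.+1 then co f i' j k else 0;
    cobM : forall f i j k, co (b * f) i j k = if j is j'.+1 then co f i j' k else 0;
    cocM : forall f i j k, co (c * f) i j k = if k is k'.+1 then co f i j k' else 0;
    unit_1Db : forall x, 1 + b * C x \is a GRing.unit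
  }.

(** * Coefficient rules for one-variable power series *)

Section FpsCoef.
Variable R : comNzRingType.
Implicit Types (f : fps R) (u : R).

Lemma fcoefCM u f n : fcoef (fpsC u * f) n = u * fcoef f n.
Proof.
rewrite fcoefM big_ord_recl subn0 big1 ?addr0 // => i _.
by rewrite mul0r.
Qed.

Lemma fcoefXM f n :
  fcoef (fpsX R * f) n = if n is m.+1 then fcoef f m else 0.
Proof.
rewrite fcoefM big_ord_recl mul0r add0r.
case: n => [|n]; first by rewrite big_ord0.
rewrite big_ord_recl mul1r subSS subn0 big1 ?addr0 // => i _.
by rewrite mul0r.
Qed.

Fact fpsC_is_zmod_morphism : zmod_morphism (@fpsC R).
Proof. by move=> u v; apply: fpsP => -[|n] //=; rewrite subr0. Qed.

Fact fpsC_is_monoid_morphism : monoid_morphism (@fpsC R).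
Proof.
split=> // u v; apply: fpsP => n.
by rewrite fcoefCM /=; case: ifP => // _; rewrite mulr0.
Qed.

HB.instance Definition _ := GRing.isZmodMorphism.Build R (fps R) (@fpsC R)
  fpsC_is_zmod_morphism.
HB.instance Definition _ := GRing.isMonoidMorphism.Build R (fps R) (@fpsC R)
  fpsC_is_monoid_morphism.

End FpsCoef.

(** * Coefficient rules in three variables *)

Section Fps3Coef.
Variable K : fieldType.
Implicit Types (f g : fps3 K) (x : K) (i j k : nat).

HB.instance Definition _ := GRing.RMorphism.copy (@fps3C K)
  (@fpsC (fps (fps K)) \o (@fpsC (fps K) \o @fpsC K)).

Lemma coef3D f g i j k : coef3 (f + g) i j k = coef3 f i j k + coef3 g i j k.
Proof. by []. Qed.

Lemma coef3C x i j k :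
  coef3 (fps3C x) i j k = if (i, j, k) == (0, 0, 0)%N then x else 0.
Proof. by rewrite /coef3 /=; case: i j k => [|i] [|j] [|k]. Qed.

Lemma coef3CM x f i j k : coef3 (fps3C x * f) i j k = x * coef3 f i j k.
Proof. by rewrite /coef3 !fcoefCM. Qed.

Lemma coef3aM f i j k :
  coef3 (fps3a K * f) i j k = if i is i'.+1 then coef3 f i' j k else 0.
Proof. by rewrite /coef3 fcoefXM; case: i => //; rewrite !fcoef0. Qed.

Lemma coef3bM f i j k :
  coef3 (fps3b K * f) i j k = if j is j'.+1 then coef3 f i j' k else 0.
Proof. by rewrite /coef3 fcoefCM fcoefXM; case: j => //; rewrite !fcoef0. Qed.

Lemma coef3cM f i j k :
  coef3 (fps3c K * f) i j k = if k is k'.+1 then coef3 f i j k' else 0.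
Proof. by rewrite /coef3 !fcoefCM fcoefXM. Qed.

(** Invertibility descends through the three layers of series, by conversion, to the constant
    coefficient in [K], which is 1 here. *)
Lemma fps3_unit_1DbM f : 1 + fps3b K * f \is a GRing.unit.
Proof.
suff: coef3 (1 + fps3b K * f) 0 0 0 \is a GRing.unit by [].
rewrite coef3D.
by rewrite coef3bM addr0 unitr1.
Qed.

Lemma fps3_is_power_series_ring :
  power_series_ring (@fps3C K) (fps3a K) (fps3b K) (fps3c K) (@coef3 K).
Proof.
split.
- exact: coef3D.
- exact: coef3C.
- exact: coef3CM.
- exact: coef3aM.
- exact: coef3bM.
- exact: coef3cM.
- by move=> x; apply: fps3_unit_1DbM.
Qed.

End Fps3Coef.

(** * Recurrences for shifted factorials *)

Lemma qpoch_homS (R : comUnitRingType) (a c y g : R) (n : nat) :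
  qpoch_hom a (- (c * y)) y n.+1 * g
  = a * (qpoch_hom a (- (c * y)) y n * g)
    + y ^+ n.+1 * (c * (qpoch_hom a (- (c * y)) y n * g)).
Proof.
(* The factor of index [n] that splits off is [a + c * y ^+ n.+1]. *)
rewrite {1}/qpoch_hom big_nat_recr //= -/(qpoch_hom a (- (c * y)) y n) exprS.
by ring.
Qed.

(** For negative [n] the new factor cancels the last denominator factor, which is why the factors
    must be units. *)
Lemma qpochS (R : comUnitRingType) (x q : R) (n : int) :
  (forall m : int, 1 - x * q ^ m \is a GRing.unit) ->
  qpoch x q (n + 1) = qpoch x q n * (1 - x * q ^ n).
Proof.
move=> ux; case: n => [n|[|n]].
- by rewrite -[n%:Z + 1]/(Posz (n + 1)%N) addn1 /= big_nat_recr.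
- by rewrite /= big_geq // big_nat1 mulVr //; exact: (ux (-1)).
- have -> : Negz n.+1 + 1 = Negz n by rewrite !NegzE; lia.
  have ux' := ux (Negz n.+1).
  (* Inverting the product factorwise requires the remaining denominator to be a unit too. *)
  rewrite /= [in RHS]big_nat_recr //= invrM //; last first.
    rewrite big_seq; apply: rpred_prod => j; rewrite mem_index_iota => /andP[j1 _].
    by case: j j1 => // j _; exact: (ux (Negz j)).
  by rewrite mulrAC mulVr // mul1r.
Qed.

(** * Gaussian binomials with integral upper index *)

Section QBinomial.
Variables (K : fieldType) (q : K).
Hypothesis q_neq0 : q != 0.
Hypothesis q_non_unity : forall n : nat, 1 - q ^+ n.+1 != 0.

Lemma tri_bin k : tri k = 'C(k.+1, 2).
Proof. by rewrite /tri bin2 divn2 mulnC. Qed.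

Lemma qpoch_qq_neq0 (k : nat) : qpoch q q k != 0.
Proof.
rewrite /= prodf_seq_neq0; apply/allP => j _.
by rewrite -exprS q_non_unity.
Qed.

Lemma qbinom0 (n : int) : qbinom q n 0%N = 1.
Proof. by rewrite /= !big_nil divr1. Qed.

Lemma qpoch_qqS (k : nat) : qpoch q q k.+1 = qpoch q q k * (1 - q ^+ k.+1).
Proof. by rewrite /= big_nat_recr //= -exprS. Qed.

(** With [m = n - j], all three numerators share the product [P] of the [j] factors starting at
    [1 - q ^ (m + 1)]. What remains is [1 - q^m q^(j+1) = (1 - q^m) + q^m (1 - q^(j+1))]. *)
Lemma qbinom_pascal (n : int) (j : nat) :
  qbinom q (n + 1) j.+1 = qbinom q n j.+1 + q ^ (n - j%:Z) * qbinom q n j.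
Proof.
rewrite /qbinom qpoch_qqS.
set D := qpoch q q j; have D0 : D != 0 by exact: qpoch_qq_neq0.
have -> : n + 1 - j.+1%:Z + 1 = n - j%:Z + 1 by lia.
have -> : n - j.+1%:Z + 1 = n - j%:Z by lia.
set m := n - j%:Z.
have -> : q ^ (m + 1) = q ^ m * q by rewrite expfzDr // expr1z.
set P := qpoch (q ^ m * q) q j.
have -> : qpoch (q ^ m * q) q j.+1 = P * (1 - q ^ m * q ^+ j.+1).
  by rewrite exprS mulrA /P /= big_nat_recr.
have -> : qpoch (q ^ m) q j.+1 = (1 - q ^ m) * P.
  rewrite /= big_nat_recl //= expr0 mulr1; congr (_ * _).
  by apply: eq_bigr => t _; rewrite exprS mulrA.
have S0 := q_non_unity j; move: (q ^+ j.+1) S0 => z z0.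
by field; rewrite z0 D0.
Qed.

Lemma qbinom_pascal_nat (n k : nat) :
  qbinom q n.+1 k.+1 = qbinom q n k.+1 + q ^ (n%:Z - k%:Z) * qbinom q n k.
Proof. by rewrite -qbinom_pascal; congr qbinom; lia. Qed.

Lemma qpochD (x : K) (m n : nat) :
  qpoch x q (m + n)%N = qpoch x q m * qpoch (x * q ^+ m) q n.
Proof.
elim: n => [|n IHn] /=; first by rewrite addn0 big_nil mulr1.
by rewrite addnS !big_nat_recr //= [X in X * _]IHn exprD !mulrA.
Qed.

Lemma qbinom_fact (i k : nat) :
  qbinom q (i + k)%N k * (qpoch q q i * qpoch q q k) = qpoch q q (i + k)%N.
Proof.
rewrite qpochD -exprS mulrCA; congr (_ * _).
rewrite /qbinom divfK ?qpoch_qq_neq0 //; congr (qpoch _ _ _).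
by rewrite exprnP; congr (q ^ _); lia.
Qed.

(** The numerator of [[M,i+k]] is that of [[M-i,k]] followed by that of [[M,i]]; [qbinom_fact]
    accounts for the denominators. *)
Lemma qbinom_trinomial (M : int) (i k : nat) :
  qbinom q M (i + k)%N * qbinom q (i + k)%N k
  = qbinom q M i * qbinom q (M - i%:Z) k.
Proof.
have num : qpoch (q ^ (M - (i + k)%N%:Z + 1)) q (i + k)%N
    = qpoch (q ^ (M - i%:Z - k%:Z + 1)) q k * qpoch (q ^ (M - i%:Z + 1)) q i.
  rewrite addnC qpochD exprnP -expfzDr //.
  congr (qpoch (q ^ _) _ _ * qpoch (q ^ _) _ _); lia.
rewrite [qbinom q M (i + k)%N]/qbinom num -qbinom_fact.
(* This factor now occurs in a denominator, where [qbinom_fact] has replaced [(q;q)_(i+k)]. *)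
have w0 : qbinom q (i + k)%N k != 0.
  apply: contraNneq (qpoch_qq_neq0 (i + k)) => w0.
  by rewrite -qbinom_fact w0 mul0r.
rewrite [qbinom q M i]/qbinom [qbinom q (M - _) k]/qbinom.
by field; rewrite w0 !qpoch_qq_neq0.
Qed.

Lemma qbinom_small (n k : nat) : (n < k)%N -> qbinom q n k = 0.
Proof.
move=> ltnk; rewrite /qbinom /=.
(* The numerator factor of index [k - n - 1] is [1 - q^0 = 0]. *)
rewrite (@big_cat_nat _ _ _ (k - n.+1)) ?leq_subr //=.
rewrite [X in _ * X / _]big_ltn; last by lia.
rewrite exprnP -expfzDr //.
have -> : n%:Z - k%:Z + 1 + (k - n.+1)%N%:Z = 0 by lia.
by rewrite subrr mul0r mulr0 mul0r.
Qed.

End QBinomial.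

(** * Coefficients of the terms on both sides *)

Section PowerSeries.
Variables (K : fieldType) (q : K).
Hypothesis q_neq0 : q != 0.
Hypothesis q_non_unity : forall n : nat, 1 - q ^+ n.+1 != 0.
Variables (S : comUnitRingType) (C : {rmorphism K -> S}) (a b c : S).
Variable co : S -> nat -> nat -> nat -> K.
Hypothesis hS : power_series_ring C a b c co.

Lemma co_monomial (x : K) (i j k i' j' k' : nat) :
  co (a ^+ i * b ^+ j * c ^+ k * C x) i' j' k' =
  if (i', j', k') == (i, j, k) then x else 0.
Proof.
elim: i i' => [|i IHi] [|i']; rewrite ?exprS -?mulrA ?(coaM hS) //; last first.
- by rewrite !mulrA IHi.
all: rewrite !expr0 mul1r.
all: elim: j j' => [|j IHj] [|j']; rewrite ?exprS -?mulrA ?(cobM hS) //.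
all: rewrite ?expr0 ?mul1r.
all: elim: k k' => [|k IHk] [|k']; rewrite ?exprS -?mulrA ?(cocM hS) //.
all: by rewrite ?expr0 ?mul1r ?(coC hS).
Qed.

(** The natural [q]-binomial theorem, by Pascal's rule. The product is homogeneous of degree [n] in
    [a] and [c]. Carrying along a series [f] in [b] alone avoids a Cauchy product later. *)
Lemma co_qpoch_hom (f : S) (g : nat -> K) (n i j k : nat) :
  (forall i j k, co f i j k = if (i == 0)%N && (k == 0)%N then g j else 0) ->
  co (qpoch_hom a (- (c * C q)) (C q) n * f) i j k
  = if n == (i + k)%N then q ^+ tri k * qbinom q n k * g j else 0.
Proof.
move=> fE; elim: n i k => [|n IHn] i k.
  rewrite /qpoch_hom big_nil mul1r fE.
  by case: i k => [|i] [|k] //; rewrite qbinom0 /tri expr0 !mul1r.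
rewrite qpoch_homS (coD hS) -(rmorphXn C) (coCM hS) (coaM hS) (cocM hS).
case: i k => [|i] [|k]; rewrite ?IHn.
- by rewrite mulr0 addr0.
- rewrite add0r !add0n eqSS; case: eqVneq => [<-|_]; last by rewrite mulr0.
  (* On the boundary [i = 0] only the [c] branch contributes, in accordance with [[n,n+1] = 0]. *)
  rewrite qbinom_pascal_nat // (@qbinom_small _ _ q_neq0 n n.+1) // subrr expr0z add0r mul1r.
  by rewrite !tri_bin [in RHS]binS bin1 exprD; ring.
- by rewrite mulr0 addr0 !addn0 eqSS !qbinom0.
rewrite !addSn eqSS addnS; case: eqVneq => [nE|_]; last first.
  by rewrite mulr0 addr0.
rewrite qbinom_pascal_nat //.
have -> : n%:Z - k%:Z = i.+1%:Z by lia.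
have -> : tri k.+1 = (k.+1 + tri k)%N by rewrite !tri_bin [in LHS]binS bin1 addnC.
rewrite -exprnP !exprD.
(* Of the weight [q^(n+1)] of [c], the part [q^(k+1)] turns [T_k] into [T_(k+1)] and [q^(i+1)] is
   the weight in Pascal's rule. *)
have -> : n.+1 = (k.+1 + i.+1)%N by lia.
by rewrite exprD; ring.
Qed.

Lemma qpoch_bS (y : K) (n : int) :
  qpoch (- (b * C y)) (C q) (n + 1)
  = qpoch (- (b * C y)) (C q) n
    + C (y * q ^ n) * (b * qpoch (- (b * C y)) (C q) n).
Proof.
have E (m : int) : 1 - - (b * C y) * C q ^ m = 1 + b * C (y * q ^ m).
  by rewrite mulNr opprK rmorphM rmorphXz ?unitfE // mulrA.
rewrite qpochS; first by rewrite E; ring.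
by move=> m; rewrite E (unit_1Db hS).
Qed.

(* The recursion [P (n+1) = (1 + b y q^n) P n] also determines [P n] from [P (n+1)], one power
   of [b] at a time; this reaches the negative [n]. *)
Lemma co_qpoch_b (y : K) (n : int) (i j k : nat) :
  co (qpoch (- (b * C y)) (C q) n) i j k
  = if (i == 0)%N && (k == 0)%N then q ^+ 'C(j, 2) * y ^+ j * qbinom q n j else 0.
Proof.
pose P n := qpoch (- (b * C y)) (C q) n.
pose g n j := q ^+ 'C(j, 2) * y ^+ j * qbinom q n j.
have gS m l : g (m + 1) l.+1 = g m l.+1 + y * q ^ m * g m l.
  rewrite /g qbinom_pascal // binS bin1 exprD exprS.
  have -> : q ^ m = q ^ (m - l%:Z) * q ^+ l by rewrite exprnP -expfzDr // subrK.
  by ring.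
have PS m l : co (P (m + 1)) i l k
    = co (P m) i l k + y * q ^ m * (if l is l'.+1 then co (P m) i l' k else 0).
  by rewrite /P qpoch_bS (coD hS) (coCM hS) (cobM hS).
(* The recursion shifts only the degree in [b], so [i] and [k] stay fixed. *)
set z := (i == 0)%N && (k == 0)%N in PS *.
pose good m := forall l, co (P m) i l k = if z then g m l else 0.
suff: good n by apply.
have gzS m l : (if z then g (m + 1) l.+1 else 0)
    = (if z then g m l.+1 else 0) + y * q ^ m * (if z then g m l else 0).
  by case: ifP => //; rewrite mulr0 addr0.
have gz0 m : (if z then g (m + 1) 0 else 0) = (if z then g m 0 else 0).
  by rewrite /g !qbinom0.
have up m : good m -> good (m + 1).
  move=> IH [|l]; rewrite PS; first by rewrite mulr0 addr0 gz0.
  by rewrite !IH gzS.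
have down m : good (m + 1) -> good m.
  move=> IH; elim=> [|l IHl].
    by rewrite -gz0 -IH PS mulr0 addr0.
  by have := IH l.+1; rewrite PS gzS IHl => /addIr.
elim/int_rect: n => [|n|n].
- move=> l; rewrite /P /= big_nil -(rmorph1 C) (coC hS) /z /g !xpair_eqE.
  case: l => [|l]; last by rewrite andbF qbinom_small // mulr0 if_same.
  by rewrite andbT qbinom0 !mul1r.
- by move/up; congr good; lia.
- by move=> IH; apply: down; move: IH; congr good; lia.
Qed.

Lemma co_lhs (L M : int) (n i j k : nat) :
  co (C q ^+ tri n * qpoch_hom a (- (c * C q)) (C q) n
      * qpoch (- (b * C q ^+ n.+1)) (C q) (L - n%:Z) * C (qbinom q M n)) i j k
  = if n == (i + k)%N then
      q ^+ (tri (i + j + k) + tri k)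
      * (qbinom q (M - i%:Z) k * qbinom q M i * qbinom q (L - i%:Z - k%:Z) j)
    else 0.
Proof.
rewrite -!(rmorphXn C) mulrC (coCM hS) -[X in co X]mulrA (coCM hS).
rewrite (co_qpoch_hom _ _ _ _ (co_qpoch_b (q ^+ n.+1) (L - n%:Z))).
case: eqVneq => [->|_]; last by rewrite !mulr0.
have -> : L - (i + k)%N%:Z = L - i%:Z - k%:Z by lia.
rewrite -exprM.
(* Here ['C(j, 2)] comes from the series in [b], and [(i + k).+1 * j] from its argument
   [y = q^(n+1)] with [n = i + k]. *)
have -> : tri (i + j + k) = (tri (i + k) + 'C(j, 2) + (i + k).+1 * j)%N.
  rewrite !tri_bin; elim: j => [|j IHj]; first by rewrite addn0 !muln0 !addn0.
  by rewrite addnS addSn binS IHj (binS j) !bin1 mulnS; lia.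
rewrite (mulrC (qbinom q (M - i%:Z) k)) -(qbinom_trinomial q_neq0 q_non_unity) !exprD.
by ring.
Qed.

Lemma co_rhs (x : K) (n i j k i' j' k' : nat) :
  co (a ^+ i * b ^+ j * c ^+ k * C q ^+ n * C x) i' j' k' =
  if (i, j, k) == (i', j', k') then q ^+ n * x else 0.
Proof. by rewrite -(rmorphXn C) -mulrA -rmorphM co_monomial eq_sym. Qed.

End PowerSeries.

(** * Families in which each monomial occurs in at most one member *)

Section SingletonSupport.
Variables (K : fieldType) (I : choiceType) (F : I -> fps3 K).
Variables (p : nat -> nat -> nat -> I) (x : nat -> nat -> nat -> K).
Hypothesis FE : forall t i j k, coef3 (F t) i j k = if t == p i j k then x i j k else 0.

Lemma fps3_summable_singleton : fps3_summable F.
Proof.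
move=> i j k; apply: (sub_finite_set _ (finite_set1 (p i j k))) => t /=.
by rewrite FE; case: eqVneq.
Qed.

Lemma fps3_sum_singleton :
  fps3_sum F = Fps (fun i => Fps (fun j => Fps (fun k => x i j k))).
Proof.
rewrite /fps3_sum; congr Fps; apply/funext => i; congr Fps; apply/funext => j.
congr Fps; apply/funext => k.
rewrite (_ : \sum_(t \in [set: I]) _ = \sum_(t \in [set p i j k]%classic) coef3 (F t) i j k).
  by rewrite fsbig_set1 FE eqxx.
(* Members other than [p i j k] contribute zero to this coefficient. *)
apply/esym/fsbig_widen => // t [_ /= /eqP] /negbTE tp.
by rewrite FE tp.
Qed.

End SingletonSupport.

(** * The variable [q] is nonzero and not a root of unity *)

Lemma ratX_neq0 (F : fieldType) : ratX F != 0.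
Proof. by rewrite /ratX tofrac_eq0 polyX_eq0. Qed.

(** Polynomials embed into fractions, and ['X^n.+1] and [1] differ in size. *)
Lemma ratX_non_unity (F : fieldType) (n : nat) : 1 - ratX F ^+ n.+1 != 0.
Proof.
rewrite subr_eq0 /ratX -tofracXn -tofrac1 tofrac_eq.
by apply/eqP => /(congr1 (fun r : {poly F} => size r)); rewrite size_polyXn size_poly1.
Qed.

Theorem theorem5p1 (F : fieldType) (L M : int) :
  let q : ratfun F := ratX F in
  let Q : fps3 (ratfun F) := fps3C q in
  let a : fps3 (ratfun F) := fps3a (ratfun F) in
  let b : fps3 (ratfun F) := fps3b (ratfun F) in
  let c : fps3 (ratfun F) := fps3c (ratfun F) in
  let lhs (i : nat) : fps3 (ratfun F) :=
    Q ^+ tri i * qpoch_hom a (- (c * Q)) Q i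
    * qpoch (- (b * Q ^+ i.+1)) Q (L - i%:Z) * fps3C (qbinom q M i) in
  let rhs (t : nat * nat * nat) : fps3 (ratfun F) :=
    let: (i, j, k) := t in
    a ^+ i * b ^+ j * c ^+ k * Q ^+ (tri (i + j + k) + tri k)
    * fps3C (qbinom q (M - i%:Z) k * qbinom q M i
             * qbinom q (L - i%:Z - k%:Z) j) in
  [/\ fps3_summable lhs, fps3_summable rhs & fps3_sum lhs = fps3_sum rhs].
Proof.
move=> q Q a b c lhs rhs.
have hS := fps3_is_power_series_ring (ratfun F).
have q0 : q != 0 := ratX_neq0 F.
have q1 : forall n : nat, 1 - q ^+ n.+1 != 0 := @ratX_non_unity F.
(* The common coefficient of [a^i b^j c^k] on both sides. *)
pose x (i j k : nat) := q ^+ (tri (i + j + k) + tri k)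
  * (qbinom q (M - i%:Z) k * qbinom q M i * qbinom q (L - i%:Z - k%:Z) j).
have lhsE n i j k : coef3 (lhs n) i j k = if n == (i + k)%N then x i j k else 0.
  exact: (co_lhs q0 q1 hS L M n i j k).
have rhsE t i j k : coef3 (rhs t) i j k = if t == (i, j, k) then x i j k else 0.
  case: t => [[i' j'] k'].
  transitivity (if (i', j', k') == (i, j, k) then x i' j' k' else 0).
    exact: (co_rhs q hS _ _ i' j' k').
  by case: eqP => // -[-> -> ->].
have lhsS := fps3_summable_singleton (p := fun i _ k => (i + k)%N) lhsE.
have rhsS := fps3_summable_singleton (p := fun i j k => (i, j, k)) rhsE.
split=> //.
(* The two families place [x] at different indices, but both sums are the series with coefficients
   [x]. *)
rewrite (fps3_sum_singleton (p := fun i _ k => (i + k)%N) lhsE).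
by rewrite (fps3_sum_singleton (p := fun i j k => (i, j, k)) rhsE).
Qed.
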